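(* Let $\mathcal{V}$ be a Mal'tsev variety of left quasigroups. Then $\mathrm{Dis}(Q)$ is transitive on $Q$ for every $Q\in \mathcal{V}$.
   Context: A left quasigroup is a (nonempty) set $Q$ with binary operations $*,\backslash$ such that $x*(x\backslash y)=y=x\backslash(x*y)$; equivalently every $L_x:y\mapsto x*y$ is a bijection. Varieties of left quasigroups are taken in the language $\{*,\backslash\}$. A variety is Mal'tsev if it has a Mal'tsev term, i.e. a ternary term $m$ satisfying $m(x,y,y)\approx x\approx m(y,y,x)$ in the variety. $\mathrm{LMlt}(Q)=\langle L_a: a\in Q\rangle$, and $\mathrm{Dis}(Q)$ is the normal closure in $\mathrm{LMlt}(Q)$ of $\{L_aL_b^{-1}:a,b\in Q\}$. *)

(* Defs.v *)
From HB Require Import structures.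
From mathcomp Require Import all_boot.
From mathcomp Require Import boolp classical_sets.

Set Implicit Arguments.
Unset Strict Implicit.
Unset Printing Implicit Defensive.

Local Open Scope classical_set_scope.
Local Open Scope group_scope.

HB.mixin Record Magma_isLeftQuasigroup Q of Magma Q := {
  ldiv : Q -> Q -> Q;
  mul_ldivK : forall x y : Q, x * ldiv x y = y;
  ldiv_mulK : forall x y : Q, ldiv x (x * y) = y;
  lquasi_inhabited : inhabited Q
}.

#[short(type="leftQuasigroupType")]
HB.structure Definition LeftQuasigroup :=
  {Q of Magma_isLeftQuasigroup Q & Magma Q}.

Inductive term (X : Type) : Type :=
| Var of X
| TMul of term X & term X
| TLdiv of term X & term X.

Fixpoint eval (Q : leftQuasigroupType) (X : Type) (v : X -> Q) (t : term X) : Q :=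
  match t with
  | Var i => v i
  | TMul s t => eval v s * eval v t
  | TLdiv s t => ldiv (eval v s) (eval v t)
  end.

(* Identities are written with variables indexed by nat. *)
Definition identity : Type := term nat * term nat.

Definition satisfies (Q : leftQuasigroupType) (e : identity) : Prop :=
  forall v : nat -> Q, eval v e.1 = eval v e.2.

(* A variety is an equational class; the ambient class already consists of
   left quasigroups, so the axioms of left quasigroups need not occur in E. *)
Definition variety (V : leftQuasigroupType -> Prop) : Prop :=
  exists E : set identity,
    forall Q : leftQuasigroupType, V Q <-> (forall e, E e -> satisfies Q e).

Definition eval3 (Q : leftQuasigroupType) (m : term 'I_3) (x y z : Q) : Q :=
  eval (fun i : 'I_3 => nth x [:: x; y; z] i) m.

Definition maltsev_term (V : leftQuasigroupType -> Prop) (m : term 'I_3) : Prop :=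
  forall Q : leftQuasigroupType, V Q ->
    forall x y : Q, eval3 m x y y = x /\ eval3 m y y x = x.

Definition maltsev_variety (V : leftQuasigroupType -> Prop) : Prop :=
  variety V /\ exists m : term 'I_3, maltsev_term V m.

(* MathComp's {perm T} requires a finite T; this is the symmetric group of an
   arbitrary type. The inverse is part of the data, so it is determined by the
   underlying function (see [sym_inj]). *)
Record sym (T : Type) : Type := Sym {
  sym_fun :> T -> T;
  sym_inv : T -> T;
  sym_funK : cancel sym_fun sym_inv;
  sym_invK : cancel sym_inv sym_fun
}.

HB.instance Definition _ (T : Type) := gen_eqMixin (sym T).
HB.instance Definition _ (T : Type) := gen_choiceMixin (sym T).

Section SymGroup.
Variable T : Type.
Implicit Types f g h : sym T.

Lemma sym_inj f g : sym_fun f =1 sym_fun g -> f = g.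
Proof.
case: f g => [f f' fK f'K] [g g' gK g'K] /= /funext fg; subst g.
have E : f' = g' by apply: funext => x; rewrite -{1}[x]g'K fK.
by subst g'; congr Sym; apply: Prop_irrelevance.
Qed.

Definition sym_one : sym T :=
  @Sym T id id (fun=> erefl) (fun=> erefl).

Definition sym_invg f : sym T := Sym (@sym_invK _ f) (@sym_funK _ f).

(* Permutations act on the left: (f * g) x = f (g x). *)
Definition sym_mul f g : sym T :=
  Sym (can_comp (@sym_funK _ f) (@sym_funK _ g))
      (can_comp (@sym_invK _ g) (@sym_invK _ f)).

Fact sym_mulA : associative sym_mul.
Proof. by move=> f g h; apply: sym_inj. Qed.
Fact sym_mul1g : left_id sym_one sym_mul.
Proof. by move=> f; apply: sym_inj. Qed.
Fact sym_mulg1 : right_id sym_one sym_mul.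
Proof. by move=> f; apply: sym_inj. Qed.
Fact sym_mulVg : left_inverse sym_one sym_invg sym_mul.
Proof. by move=> f; apply: sym_inj => x /=; rewrite sym_funK. Qed.
Fact sym_mulgV : right_inverse sym_one sym_invg sym_mul.
Proof. by move=> f; apply: sym_inj => x /=; rewrite sym_invK. Qed.

HB.instance Definition _ := isGroup.Build (sym T)
  sym_mulA sym_mul1g sym_mulg1 sym_mulVg sym_mulgV.

End SymGroup.

Section Generation.
Variable G : groupType.
Implicit Types (A H N : set G).

Definition is_subgroup H : Prop := group_closed [in H].

Definition generated A : set G := smallest is_subgroup A.

Definition normal_subgroup H N : Prop :=
  [/\ is_subgroup N, N `<=` H & forall h n, H h -> N n -> N (n ^ h)].

(* Meaningful when H is a subgroup containing A. *)
Definition normal_closure H A : set G := smallest (normal_subgroup H) A.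

End Generation.

Definition transitive_on (T : Type) (H : set (sym T)) : Prop :=
  forall x y : T, exists2 h : sym T, H h & h x = y.

Definition L (Q : leftQuasigroupType) (a : Q) : sym Q :=
  Sym (ldiv_mulK a) (mul_ldivK a).

Definition LMlt (Q : leftQuasigroupType) : set (sym Q) :=
  generated (range (@L Q)).
Arguments LMlt Q : clear implicits.

Definition Dis (Q : leftQuasigroupType) : set (sym Q) :=
  normal_closure (LMlt Q) [set g | exists a b : Q, g = L a / L b].
Arguments Dis Q : clear implicits.

(* Main.v *)
From mathcomp Require Import all_boot.
From mathcomp Require Import boolp classical_sets.
Require Import Defs.

(** Modulo the orbits of [Dis Q] all left translations agree, so a term
    operation depends, up to orbits, on a single variable. For a Mal'tsev term
    [m] the values [m(y,y,y) = y], [m(x,y,y) = x] and [m(y,y,x) = x] then put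
    any [x] and [y] in the same orbit. *)

Set Implicit Arguments.
Unset Strict Implicit.
Unset Printing Implicit Defensive.

Local Open Scope classical_set_scope.
Local Open Scope group_scope.

Section Generation.
Variable G : groupType.
Implicit Types (A H : set G).

Lemma is_subgroupP H :
  is_subgroup H <-> H 1 /\ (forall x y, H x -> H y -> H (x / y)).
Proof.
split=> -[H1 HB]; split; [| | |].
- by move: H1; rewrite !inE.
- by move=> x y Hx Hy; have := HB x y; rewrite !inE; apply.
- by rewrite !inE.
- by move=> x y; rewrite !inE; apply: HB.
Qed.

Lemma sub_generated A : A `<=` generated A.
Proof. exact: sub_smallest. Qed.

Lemma is_subgroup_generated A : is_subgroup (generated A).
Proof.
apply/is_subgroupP; split=> [H [/is_subgroupP[] //]|x y Ax Ay H sH].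
by have [/is_subgroupP[_ HB] _] := sH; apply: HB; [apply: Ax|apply: Ay].
Qed.

Lemma sub_normal_closure H A : A `<=` normal_closure H A.
Proof. exact: sub_smallest. Qed.

Lemma is_subgroup_normal_closure H A : is_subgroup (normal_closure H A).
Proof.
apply/is_subgroupP; split=> [N [[/is_subgroupP[] //]]|x y Ax Ay N sN].
by have [[/is_subgroupP[_ NB] _ _] _] := sN; apply: NB; [apply: Ax|apply: Ay].
Qed.

Lemma normal_closureJ H A h n :
  H h -> normal_closure H A n -> normal_closure H A (n ^ h).
Proof.
by move=> Hh An N sN; have [[_ _ NJ] _] := sN; apply: NJ => //; apply: An.
Qed.

End Generation.

Definition same_orbit (T : Type) (H : set (sym T)) (x y : T) : Prop :=
  exists2 h : sym T, H h & h x = y.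

Section SameOrbit.
Variables (T : Type) (H : set (sym T)).
Hypothesis sgH : is_subgroup H.

Lemma same_orbit_refl x : same_orbit H x x.
Proof. by have /is_subgroupP[H1 _] := sgH; exists 1. Qed.

Lemma same_orbit_sym x y : same_orbit H x y -> same_orbit H y x.
Proof.
have [H1 HB] := (is_subgroupP H).1 sgH.
case=> h Hh <-; exists (1 / h); first exact: HB.
by rewrite /= sym_funK.
Qed.

Lemma same_orbit_trans x y z :
  same_orbit H x y -> same_orbit H y z -> same_orbit H x z.
Proof.
have [H1 HB] := (is_subgroupP H).1 sgH.
(* Closure is available only under [x / y], so the product [h * g] is written as [h / (1 / g)]. *)
case=> g Hg <- [h Hh <-]; exists (h / (1 / g)) => //.
by apply: (HB) => //; apply: HB.
Qed.

End SameOrbit.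

Section Displacement.
Variable Q : leftQuasigroupType.
Local Notation "x ~ y" := (same_orbit (Dis Q) x y) (at level 70).

Let sgDis : is_subgroup (Dis Q) := is_subgroup_normal_closure _ _.

Lemma LMlt_L (a : Q) : LMlt Q (L a).
Proof. by apply: sub_generated; exists a. Qed.

Lemma LMlt_V (g : sym Q) : LMlt Q g -> LMlt Q g^-1.
Proof.
have /is_subgroupP[L1 LB] := is_subgroup_generated (range (@L Q)).
by move=> Lg; rewrite -[_^-1]mul1g; apply: LB.
Qed.

Lemma Dis_LdivL (a b : Q) : Dis Q (L a / L b).
Proof. by apply: sub_normal_closure; exists a, b. Qed.

(** By normality of [Dis Q]: if [h x = y], then [g h g^-1], which is [h ^ g^-1], takes [g x] to
    [g y]. *)
Lemma same_orbit_LMlt (g : sym Q) (x y : Q) : LMlt Q g -> x ~ y -> g x ~ g y.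
Proof.
move=> Lg [h Dh <-]; exists (h ^ g^-1); first exact: normal_closureJ (LMlt_V Lg) Dh.
by rewrite /conjg invgK /= sym_funK.
Qed.

Lemma same_orbit_mul (a b x y : Q) : x ~ y -> a * x ~ b * y.
Proof.
move=> xy; apply: (same_orbit_trans sgDis (y := a * y)).
  by apply: (same_orbit_LMlt (g := L a)) xy; apply: LMlt_L.
(* Changing the left factor costs one displacement: [L b / L a] undoes [L a], then applies [L b]. *)
by exists (L b / L a); [exact: Dis_LdivL | rewrite /= ldiv_mulK].
Qed.

Lemma same_orbit_ldiv (a b x y : Q) : x ~ y -> ldiv a x ~ ldiv b y.
Proof.
move=> xy; apply: (same_orbit_trans sgDis (y := ldiv b x)).
  (* This conjugate equals [(L b)^-1 * L a], which takes [ldiv a x] to [ldiv b x]. *)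
  exists ((L a / L b) ^ L b).
    by apply: normal_closureJ (LMlt_L b) (Dis_LdivL a b).
  by rewrite /conjg /= ldiv_mulK mul_ldivK.
by apply: (same_orbit_LMlt (g := (L b)^-1)) xy; apply: LMlt_V (LMlt_L b).
Qed.

(** Here [i] is the rightmost variable of [t]. Left operands do not affect the orbit, so each is
    replaced by the fixed [a]; this makes [f] independent of [v]. *)
Lemma eval_same_orbit (a : Q) (X : Type) (t : term X) :
  exists i (f : Q -> Q), forall v : X -> Q, f (v i) ~ eval v t.
Proof.
elim: t => [i|s _ t [i [f ft]]|s _ t [i [f ft]]].
- by exists i, id => v; apply: same_orbit_refl.
- by exists i, (fun x => a * f x) => v; apply: same_orbit_mul.
- by exists i, (fun x => ldiv a (f x)) => v; apply: same_orbit_ldiv.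
Qed.

Lemma maltsev_transitive_Dis (m : term 'I_3) :
  (forall x y : Q, eval3 m x y y = x /\ eval3 m y y x = x) ->
  transitive_on (Dis Q).
Proof.
move=> mE x y; have [i [f fm]] := eval_same_orbit x m.
(* All three arguments are [y], so the position [i] is irrelevant. *)
have fy : f y ~ y.
  have := fm (fun j : 'I_3 => nth y [:: y; y; y] j).
  rewrite -/(eval3 m y y y) (mE y y).1.
  by case: i {fm} => [[|[|[|]]]].
suff fyx : f y ~ x by apply: (same_orbit_trans sgDis _ fy); apply: same_orbit_sym.
(* Whichever [i] is, one of the two identities puts [y] there: [m(y,y,x) = x] serves for [i = 0],
   [m(x,y,y) = x] for [i = 2], either for [i = 1]. The [nth] defaults match those in [eval3], so
   that it folds back. *)
have := fm (fun j : 'I_3 => nth x [:: x; y; y] j).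
have := fm (fun j : 'I_3 => nth y [:: y; y; x] j).
rewrite -/(eval3 m x y y) -/(eval3 m y y x) (mE x y).1 (mE x y).2.
by case: i {fm} => [[|[|[|]]]].
Qed.

End Displacement.

Theorem proposition5p1 (V : leftQuasigroupType -> Prop) (HV : maltsev_variety V)
  (Q : leftQuasigroupType) (HQ : V Q) : transitive_on (Dis Q).
Proof. by have [_ [m /(_ Q HQ)]] := HV; apply: maltsev_transitive_Dis. Qed.
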